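(* Let $(X,d)$ be a metric space, let $k\ge 1$ and $p_1,p_2,\ldots,p_k\in X$, and let $D=X\setminus\{p_1,p_2,\ldots,p_k\}$. Then for all $x,y\in D$, $$\hat{\tau}_D(x,y)\le 2\,j_D(x,y).$$
   Context: For a metric space $(X,d)$, points $p_1,\ldots,p_k\in X$ and $D=X\setminus\{p_1,\ldots,p_k\}$, write $d(x)=\min_{1\le i\le k}d(x,p_i)$ for $x\in D$ (the distance from $x$ to the boundary of $D$). The average scale-invariant Cassinian metric of $D$ is $$\hat{\tau}_D(x,y)=\frac1k\sum_{i=1}^k\log\left(1+2\frac{d(x,y)}{\sqrt{d(x,p_i)\,d(y,p_i)}}\right),\quad x,y\in D.$$ The distance ratio metric $j_D$ (Gehring–Osgood form) is $$j_D(x,y)=\frac12\log\left[\left(1+\frac{d(x,y)}{d(x)}\right)\left(1+\frac{d(x,y)}{d(y)}\right)\right],\quad x,y\in D.$$ *)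

(* Defs.v *)
From mathcomp Require Import all_boot all_order all_algebra.
From mathcomp Require Import all_classical all_reals all_analysis.

Set Implicit Arguments.
Unset Strict Implicit.
Unset Printing Implicit Defensive.

Import Order.TTheory GRing.Theory Num.Theory.

Local Open Scope classical_set_scope.
Local Open Scope ring_scope.

Section punctured_metric_space.
Context {R : realType} {X : metricType R} {k : nat}.
Implicit Types (p : 'I_k -> X) (x y : X).

Definition punctured p : set X := ~` range p.

(* [Num.min] on R has no neutral element, so the iterated minimum starts from
   the first of the k distances, which is counted twice; this is where
   0 < k is used. *)
Definition bdist (k_gt0 : (0 < k)%N) p x : R :=
  \big[Num.min/mdist x (p (Ordinal k_gt0))]_(i < k) mdist x (p i).

(* Only meaningful for x and y in [punctured p]; the same goes for [j_metric],
   since division by 0 returns 0. *)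
Definition tau_hat p x y : R :=
  k%:R^-1 * \sum_(i < k)
    ln (1 + 2 * (mdist x y / Num.sqrt (mdist x (p i) * mdist y (p i)))).

Definition j_metric (k_gt0 : (0 < k)%N) p x y : R :=
  2^-1 * ln ((1 + mdist x y / bdist k_gt0 p x) *
             (1 + mdist x y / bdist k_gt0 p y)).

End punctured_metric_space.

(* Main.v *)
(** AM-GM gives [1 + 2 t / sqrt (a b) <= (1 + t / a) (1 + t / b)] for [t >= 0].
    With [t = d(x,y)], [a = d(x,p_i)] and [b = d(y,p_i)], the right-hand side
    only grows when [a] and [b] are replaced by the distances to the boundary,
    so every term of the average is already at most [2 j_D(x,y)]. *)
Require Import Defs.
From mathcomp Require Import all_boot all_order all_algebra.
From mathcomp Require Import all_classical all_reals all_analysis.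
From mathcomp Require Import ring.
Import Order.TTheory GRing.Theory Num.Theory.
Local Open Scope classical_set_scope.
Local Open Scope ring_scope.

(** In terms of the inverse roots [u] and [v] of [a] and [b], both sides are polynomials whose
    difference is [t] times a square plus a square. Zero values of [a] or [b] are harmless because
    the inverse of 0 is 0. *)
Lemma one_add_div_sqrt_le (R : rcfType) (t a b : R) :
  0 <= t -> 0 <= a -> 0 <= b ->
  1 + 2 * (t / Num.sqrt (a * b)) <= (1 + t / a) * (1 + t / b).
Proof.
move=> t0 a0 b0; rewrite sqrtrM // -{2}(sqr_sqrtr a0) -{2}(sqr_sqrtr b0).
rewrite invfM -!exprVn -subr_ge0.
set u := (Num.sqrt a)^-1; set v := (Num.sqrt b)^-1.
have -> : (1 + t * u ^+ 2) * (1 + t * v ^+ 2) - (1 + 2 * (t * (u * v))) =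
          t * (u - v) ^+ 2 + (t * u * v) ^+ 2 by ring.
exact: addr_ge0 (mulr_ge0 t0 (sqr_ge0 _)) (sqr_ge0 _).
Qed.

Lemma punctured_mdist_gt0 (R : realType) (X : metricType R) (k : nat)
    (p : 'I_k -> X) (x : X) (i : 'I_k) :
  punctured p x -> 0 < mdist x (p i).
Proof.
by move=> Dx; rewrite mdist_gt0; apply/eqP => xpi; apply: Dx; exists i.
Qed.

Lemma bdist_gt0 (R : realType) (X : metricType R) (k : nat)
    (k_gt0 : (0 < k)%N) (p : 'I_k -> X) (x : X) :
  punctured p x -> 0 < bdist k_gt0 p x.
Proof.
(* The starting value of the iterated minimum must be positive too; it is itself a distance to one
   of the punctures. *)
by move=> Dx; apply: lt_bigmin => [|i _]; exact: punctured_mdist_gt0.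
Qed.

Lemma bdist_le (R : realType) (X : metricType R) (k : nat)
    (k_gt0 : (0 < k)%N) (p : 'I_k -> X) (x : X) (i : 'I_k) :
  bdist k_gt0 p x <= mdist x (p i).
Proof. exact: bigmin_le. Qed.

Lemma one_add_div_mdist_le (R : realType) (X : metricType R) (k : nat)
    (k_gt0 : (0 < k)%N) (p : 'I_k -> X) (x : X) (i : 'I_k) (t : R) :
  punctured p x -> 0 <= t ->
  1 + t / mdist x (p i) <= 1 + t / bdist k_gt0 p x.
Proof.
move=> Dx t0; rewrite lerD2l ler_wpM2l // lef_pV2 ?posrE ?bdist_gt0 //.
  exact: bdist_le.
exact: punctured_mdist_gt0.
Qed.

Theorem theorem3p6 (R : realType) (X : metricType R) (k : nat)
    (k_gt0 : (0 < k)%N) (p : 'I_k -> X) (x y : X)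
    (Dx : punctured p x) (Dy : punctured p y) :
  tau_hat p x y <= 2 * j_metric k_gt0 p x y.
Proof.
(* The factor 2 cancels the one half in [j_metric], leaving the single logarithm [L]. *)
rewrite /tau_hat /j_metric mulrA divff // mul1r.
set L := ln _.
have kR : 0 < k%:R :> R by rewrite ltr0n.
rewrite mulrC ler_pdivrMr //.
(* Once the factor 1/k is cleared, the bound is a sum of [k] copies of [L], so terms can be compared
   one by one. *)
suff le_term i : ln (1 + 2 * (mdist x y /
    Num.sqrt (mdist x (p i) * mdist y (p i)))) <= L.
  apply: le_trans (ler_sum _ (fun i _ => le_term i)) _.
  by rewrite sumr_const card_ord mulr_natr.
have t0 : 0 <= mdist x y := mdist_ge0 x y.
have one_add_gt0 (c : R) : 0 <= c -> 0 < 1 + c by exact: ltr_pwDl ltr01.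
(* Comparing logarithms through their arguments requires both arguments to be positive. *)
rewrite ler_ln ?posrE; last 2 first.
- by rewrite one_add_gt0 // mulr_ge0 // divr_ge0 ?sqrtr_ge0.
- by rewrite mulr_gt0 // one_add_gt0 // divr_ge0 // ltW // bdist_gt0.
(* After AM-GM, the two factors are enlarged separately; multiplying these bounds uses that the
   smaller factors are nonnegative. *)
apply: le_trans (one_add_div_sqrt_le _ _ _ _ _ _ _) _; rewrite ?mdist_ge0 //.
by apply: ler_pM; rewrite ?one_add_div_mdist_le // addr_ge0 ?divr_ge0 ?mdist_ge0.
Qed.
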